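(* Let $r\in(0,1]$. There exists a smooth convex set $E\subset\mathbb{R}^2$ such that, for no $T>0$, does there exist an evolution $\{E_t\}_{t\in[0,T)}$ with $E_0=E$ according to the flow $\partial_t x_t\cdot\nu_{E_t}(x_t)=-\kappa_r(E_t,x_t)$, $x_t\in\partial E_t$, which is $C^1$ in time for $t\in[0,T)$ and such that $E_t$ is convex for all $t\in(0,T)$.
   Context: Balls are open. For $E\subset\mathbb{R}^2$ with $C^2$ boundary and $x\in\partial E$, let $\nu_E(x)$ be the external unit normal, $\kappa(E,x)$ the curvature of $\partial E$ at $x$ (nonnegative for convex sets), and $B^{\mathrm{ext}}_{r,x}:=B_r(x+r\nu_E(x))$, $B^{\mathrm{int}}_{r,x}:=B_r(x-r\nu_E(x))$. The $r$-curvature is $\kappa_r(E,x):=\kappa_r^+(E,x)+\kappa_r^-(E,x)$, where $\kappa_r^+(E,x):=\frac{\kappa(E,x)}2+\frac1{2r}$ if $B^{\mathrm{ext}}_{r,x}\subseteq\mathbb{R}^2\setminus E$ and $\kappa_r^+(E,x):=0$ otherwise; $\kappa_r^-(E,x):=\frac{\kappa(E,x)}2-\frac1{2r}$ if $B^{\mathrm{int}}_{r,x}\subseteq E$ and $\kappa_r^-(E,x):=0$ otherwise. Regularity convention: that a convexity-preserving evolution $E_t$ is $C^1$ in time for $t\in[0,T)$ means that the boundary of $E_t$ is locally parameterized (as a graph) by a convex function of the space variable which is $C^1$ in time up to $t=0$; the flow equation holds in the classical sense, including at $t=0$. *)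

(* Defs.v *)
From HB Require Import structures.
From mathcomp Require Import all_boot all_order all_algebra.
From mathcomp Require Import all_classical all_reals all_analysis.

Set Implicit Arguments.
Unset Strict Implicit.
Unset Printing Implicit Defensive.

Import Order.TTheory GRing.Theory Num.Theory.
Import numFieldNormedType.Exports.

Local Open Scope classical_set_scope.
Local Open Scope ring_scope.

Section Plane.
Context {R : realType}.
Implicit Types (x e : (R * R)%type) (E : set (R * R)%type).

Definition dotp (x y : (R * R)%type) : R := x.1 * y.1 + x.2 * y.2.

(* The library's [ball] on [R * R] is a square (sup norm); this is the open
   Euclidean disk. *)
Definition disk x (r : R) : set (R * R)%type :=
  [set y | dotp (y - x) (y - x) < r ^+ 2].

Definition boundary E : set (R * R)%type := closure E `\` E°.

(* [e] rotated by -pi/2, so that [tangent (0, 1) = (1, 0)]. *)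
Definition tangent e : (R * R)%type := (e.2, - e.1).

(* The point with coordinates [(s, y)] in the orthonormal frame
   [(tangent e, e)] centred at [x]. *)
Definition frame_pt x e (s y : R) : (R * R)%type :=
  x + s *: tangent e + y *: e.

(* In the open rectangle [|s| < a, |y| < b] of the frame [(tangent e, e)] at
   [x], the boundary of [E] is the graph of [u], and [E] lies on the side of
   [e]. Points of the graph may or may not belong to [E]. *)
Definition local_graph E x e (a b : R) (u : R -> R) : Prop :=
  [/\ 0 < a, 0 < b, dotp e e = 1,
      (forall s : R, `|s| < a -> `|u s| < b) &
      forall s y : R, `|s| < a -> `|y| < b ->
        [/\ (boundary E (frame_pt x e s y) <-> y = u s),
            (u s < y -> E (frame_pt x e s y)) &
            (y < u s -> ~ E (frame_pt x e s y))]].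

Definition Ck_on (k : nat) (a : R) (u : R -> R) : Prop :=
  forall s : R, `|s| < a ->
    (forall i, (i < k)%N -> derivable (derive1n i u) s 1) /\
    {for s, continuous (derive1n k u)}.

Definition Ck_boundary (k : nat) E : Prop :=
  forall x, boundary E x ->
    exists e (a b : R) u, local_graph E x e a b u /\ Ck_on k a u.

Definition smooth_boundary E : Prop :=
  forall x, boundary E x ->
    exists e (a b : R) u, local_graph E x e a b u /\ forall k, Ck_on k a u.

(* At a boundary point with a [C^1] (resp. [C^2]) graph representation, the
   value below does not depend on the representation. *)
Definition is_outer_normal E x (n : (R * R)%type) : Prop :=
  exists e (a b : R) u, [/\ local_graph E x e a b u, Ck_on 1 a u &
    n = (Num.sqrt (1 + (derive1 u 0) ^+ 2))^-1 *: (derive1 u 0 *: tangent e - e)].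

(* With [E] above the graph, [u'' >= 0] for convex [E], hence the sign. *)
Definition is_curvature E x (k : R) : Prop :=
  exists e (a b : R) u, [/\ local_graph E x e a b u, Ck_on 2 a u &
    k = derive1n 2 u 0 / Num.sqrt (1 + (derive1 u 0) ^+ 2) ^+ 3].

Definition outer_normal E x : (R * R)%type := xget 0 (is_outer_normal E x).

Definition curvature E x : R := xget 0 (is_curvature E x).

Definition ext_ball r E x := disk (x + r *: outer_normal E x) r.

Definition int_ball r E x := disk (x - r *: outer_normal E x) r.

Definition kappa_plus (r : R) E x : R :=
  if `[< ext_ball r E x `<=` ~` E >]
  then curvature E x / 2 + 1 / (2 * r) else 0.

Definition kappa_minus (r : R) E x : R :=
  if `[< int_ball r E x `<=` E >]
  then curvature E x / 2 - 1 / (2 * r) else 0.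

Definition r_curvature (r : R) E x : R := kappa_plus r E x + kappa_minus r E x.

End Plane.

(* Derivative of [f] at [t] along [D]; one-sided at an endpoint of [D]. *)
Definition derivative_within {R : realType} {V : normedModType R}
    (D : set R) (f : R -> V) (t : R) (l : V) : Prop :=
  h^-1 *: (f (t + h) - f t) @[h --> within [set h | D (t + h)] 0^'] --> l.

Section Evolution.
Context {R : realType}.
Implicit Types (T : R) (Et : R -> set (R * R)%type).

(* Around each boundary point and each time [t0], in a frame and a rectangle
   independent of time, the boundary of [Et t] is the graph of a convex function
   [u t], and [t |-> u t s] is [C^1] for each fixed [s], up to [t = 0]. *)
Definition C1_in_time T Et : Prop :=
  forall t0 : R, t0 \in `[0, T[ -> forall x, boundary (Et t0) x ->
  exists (e : (R * R)%type) (a b eta : R) (u : R -> R -> R),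
    let J : set R := `[0, T[ `&` [set t | `|t - t0| < eta] in
    [/\ 0 < eta,
        (forall t, J t -> local_graph (Et t) x e a b (u t)),
        (forall t, J t ->
           convex_function ([set s | `|s| < a] : set R^o) (u t)) &
        forall s : R, `|s| < a -> exists v : R -> R,
          (forall t, J t -> derivative_within J (u ^~ s) t (v t)) /\
          {within J, continuous v}].

(* The flow equation is required along every curve [x t] of boundary points
   defined near [t0] in [[0, T[] and differentiable at [t0], with velocity
   [w]. *)
Definition r_curvature_flow (r : R) T Et : Prop :=
  (forall t : R, t \in `[0, T[ -> Ck_boundary 2 (Et t)) /\
  forall t0 : R, t0 \in `[0, T[ -> forall (x : R -> (R * R)%type) (w : (R * R)%type),
    (\forall t \near within `[0, T[ (nbhs t0), boundary (Et t) (x t)) ->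
    derivative_within `[0, T[ x t0 w ->
    dotp w (outer_normal (Et t0) (x t0)) = - r_curvature r (Et t0) (x t0).

End Evolution.

(* Main.v *)
Require Import Defs.
From mathcomp Require Import all_boot all_order all_algebra.
From mathcomp Require Import all_classical all_reals all_analysis.
From mathcomp Require Import ring lra.
Import Order.TTheory GRing.Theory Num.Theory.
Import numFieldNormedType.Exports.
Local Open Scope classical_set_scope.
Local Open Scope ring_scope.

(** The obstruction is the jump of the [r]-curvature along a flat part of the
boundary. On a segment of the boundary where the curvature vanishes, the
exterior disk is always outside [E], so the [r]-curvature is [0] where the
interior disk of radius [r] is inside [E], and [1 / (2 * r)] where it is not.
Suppose that it passes from [0] to [1 / (2 * r)] at a point [x] inside the
segment. In a fixed frame at [x] the boundary of [E_t] is the graph of a convex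
function [u t], and [u 0] is affine near [0]. Hence [(u t - u 0) / t] is convex
near [0], and so is its limit as [t] goes to [0+], the initial velocity. But
the flow equation makes this velocity [0] on one side of [x] and a positive
constant on the other side, and no convex function jumps inside its domain.
This is [no_convex_flow]; it compares the initial velocities at the three points
[- h], [h] and [3 * h] of the frame.

For the set, take the epigraph of the smooth convex nondecreasing function
[g x = K * exp (x - 1 / x)] for [0 < x], [g x = 0] for [x <= 0]. The disk of
radius [r] tangent to the axis at [(s, 0)] is inside the epigraph for [s = - r],
but for [s > - r / 4] it contains [(s + r / 2, r)], which is not above the
graph when [K] is chosen so that [g (r / 4) = r]. Since [g] is nondecreasing,
the set of the [s] for which the disk is inside is an interval unbounded to the
left; its supremum is negative, hence interior to the flat part, and this is
where the jump takes place ([exists_smooth_convex_jump]).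

The frame of the evolution is not the one of the epigraph, nor are the frames
that define the normal and the curvature. [flat_local_graph] handles all of
them at once: at a flat point, any frame in which the boundary is a graph gives
a linear graph of slope [e.1 / e.2] with [0 < e.2]. *)

Set Implicit Arguments.
Unset Strict Implicit.
Unset Printing Implicit Defensive.

(** * A smooth convex function that vanishes on a half-line *)

Section FlatFunction.
Context {R : realType}.
Implicit Types (p : {poly R}) (x y : R).

(** Termwise: [y ^ n <= n! * exp y] for [0 <= y]. *)
Lemma horner_le_expR p :
  exists2 C : R, 0 <= C & forall y, 0 <= y -> `|p.[y]| <= C * expR y.
Proof.
exists (\sum_(i < size p) `|p`_i| * i`!%:R).
  by apply: sumr_ge0 => i _; rewrite mulr_ge0.
move=> y y0; rewrite horner_coef mulr_suml.
apply: le_trans (ler_norm_sum _ _ _) _; apply: ler_sum => i _.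
rewrite normrM -mulrA ler_wpM2l// normrX ger0_norm//.
case: (nat_of_ord i) => [|n].
  by rewrite expr0 fact0 mul1r (le_trans _ (expR_ge1Dx _)) ?lerDl.
rewrite mulrC -ler_pdivrMr ?ltr0n ?fact_gt0//.
by apply: le_trans (expR_ge1Dxn n y0); rewrite lerDr.
Qed.

(** The factor [p (1 / x)] makes the family closed under derivation. The term
[x] in the exponent is there for convexity on all of [R]: the function
[exp (- 1 / x)] alone is convex only for [x <= 1 / 2]. *)
Definition flat_exp p x : R :=
  if 0 < x then p.[x^-1] * expR (x - x^-1) else 0.

Definition flat_exp_deriv p : {poly R} := p + 'X^2 * (p - p^`()).

(** With [y = 1 / x], this is the bound [p (y) * y ^ 2 <= C * exp y]; it gives
the derivative at [0]. *)
Lemma flat_exp_quadratic p :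
  exists C : R, forall x, x <= 1 -> `|flat_exp p x| <= C * x ^+ 2.
Proof.
have [C C0 hC] := horner_le_expR (p * 'X^2).
exists (C * expR 1) => x x1; rewrite /flat_exp.
case: ifPn => [x0|_]; last first.
  by rewrite normr0 mulr_ge0 ?sqr_ge0// mulr_ge0 ?expR_ge0.
have y0 : 0 <= x^-1 by rewrite invr_ge0 ltW.
have := hC _ y0; rewrite hornerM hornerXn normrM normrX (ger0_norm y0).
rewrite exprVn ler_pdivrMr ?exprn_gt0// => h.
rewrite normrM (ger0_norm (expR_ge0 _)) expRB.
rewrite mulrA ler_pdivrMr ?expR_gt0//.
apply: le_trans (ler_wpM2r (expR_ge0 _) h) _.
have w0 : 0 <= C * expR x^-1 * x ^+ 2.
  by rewrite mulr_ge0 ?sqr_ge0// mulr_ge0 ?expR_ge0.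
have : expR x <= expR 1 by rewrite ler_expR.
by move=> /(ler_wpM2l w0); lra.
Qed.

Lemma is_derive_quadratic (f : R -> R) (C : R) :
  (\forall x \near 0, `|f x| <= C * x ^+ 2) -> is_derive (0 : R) 1 f 0.
Proof.
move=> fC; have f0 : f 0 = 0.
  by have := nbhs_singleton fC; rewrite expr0n mulr0 normr_le0 => /eqP.
suff h : h^-1 *: ((f \o shift 0) (h *: 1) - f 0) @[h --> 0^'] --> (0 : R).
  by split; [exact: cvgP h|exact: cvg_lim h].
have cvgn : C * `|h| @[h --> (0 : R)^'] --> C * 0.
  by apply: cvgMr; apply/norm_cvg0P; exact: cvg_within.
rewrite mulr0 in cvgn.
apply/norm_cvg0P; apply: squeeze_cvgr (cvg_cst 0) cvgn.
near=> h; rewrite normr_ge0 f0 subr0 /= addr0 [_%:A]mulr1.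
have h0 : h != 0 by near: h; exact: nbhs_dnbhs_neq.
rewrite normrM normfV ler_pdivrMl ?normr_gt0//.
have -> : `|h| * (C * `|h|) = C * h ^+ 2.
  by rewrite -real_normK ?num_real//; ring.
by near: h; exact: cvg_within.
Unshelve. all: by end_near. Qed.

Lemma is_derive_flat_exp p x :
  is_derive x 1 (flat_exp p) (flat_exp (flat_exp_deriv p) x).
Proof.
rewrite {2}/flat_exp; case: ltgtP => [x0|x0|<-].
- apply: (@near_eq_is_derive _ _ _ (fun y => p.[y^-1] * expR (y - y^-1))).
    by near=> y; rewrite /flat_exp ifT//; near: y; exact: lt_nbhsr.
  have xn0 : x != 0 by rewrite gt_eqF.
  have dV : is_derive x 1 (fun y : R => y^-1) (- x ^- 2 *: 1).
    exact: is_deriveV.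
  have dp := is_derive1_comp (is_derive_poly p x^-1) dV.
  have dB : is_derive x 1 (fun y : R => y - y^-1) (1 - (- x ^- 2 *: 1)).
    exact: is_deriveB.
  have de := @is_derive1_comp _ expR (fun y => y - y^-1) x _ _
    (is_derive_expR _) dB.
  apply: is_derive_eq (is_deriveM dp de) _.
  rewrite /flat_exp_deriv !hornerE /= /GRing.scale /=.
  by field.
- apply: (@near_eq_is_derive _ _ _ (cst 0)).
    near=> y; rewrite /flat_exp ifF//; apply/negbTE; rewrite -leNgt ltW//.
    by near: y; exact: lt_nbhsl.
- have [C hC] := flat_exp_quadratic p.
  apply: (@is_derive_quadratic _ C).
  by near=> y; apply: hC; rewrite ltW//; near: y; apply: lt_nbhsl.
Unshelve. all: by end_near. Qed.

Lemma derive1n_flat_exp n p :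
  derive1n n (flat_exp p) = flat_exp (iter n flat_exp_deriv p).
Proof.
elim: n => [//|n IH]; rewrite derive1nS IH iterS; apply/funext => x.
by rewrite derive1E; apply: derive_val; exact: is_derive_flat_exp.
Qed.

Lemma derivable_derive1n_flat_exp n p x :
  derivable (derive1n n (flat_exp p)) x 1.
Proof.
rewrite derive1n_flat_exp; apply: ex_derive; exact: is_derive_flat_exp.
Qed.

Lemma continuous_flat_exp p : continuous (flat_exp p).
Proof.
move=> x; apply/differentiable_continuous/derivable1_diffP.
exact: (@derivable_derive1n_flat_exp 0).
Qed.

Lemma flat_exp_le0 p x : x <= 0 -> flat_exp p x = 0.
Proof. by move=> x0; rewrite /flat_exp ltNge x0. Qed.

Lemma flat_exp_const_gt0 (c x : R) : 0 < c -> 0 < x -> 0 < flat_exp c%:P x.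
Proof. by move=> c0 x0; rewrite /flat_exp x0 hornerC mulr_gt0 ?expR_gt0. Qed.

Lemma flat_exp_const_homo (c : R) : 0 <= c ->
  {homo flat_exp c%:P : x y / x <= y}.
Proof.
move=> c0 x y xy; rewrite /flat_exp; case: ifPn => x0; last first.
  by case: ifP => // _; rewrite hornerC mulr_ge0 ?expR_ge0.
have y0 := lt_le_trans x0 xy; rewrite y0 !hornerC ler_wpM2l// ler_expR.
by rewrite lerB// lef_pV2.
Qed.

(** With [w = 1 / x], the second derivative is an exponential times
[c * (w ^ 4 - 2 w ^ 3 + 2 w ^ 2 + 1)], which is nonnegative. *)
Lemma flat_exp_const_convex (c : R) : 0 <= c ->
  convex_function (setT : set R^o) (flat_exp c%:P).
Proof.
move=> c0 t x y _ _.
wlog xy : t x y / x <= y => [H|].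
  have [/H//|/ltW yx] := leP x y.
  by rewrite convC [leRHS]convC; exact: H.
have D1z q u : 'D_1 (flat_exp q) u = flat_exp (flat_exp_deriv q) u.
  by apply: derive_val; exact: is_derive_flat_exp.
have D1 q : 'D_1 (flat_exp q) = flat_exp (flat_exp_deriv q) by exact/funext/D1z.
apply: second_derivative_convex => //; rewrite ?D1.
- move=> z _; rewrite /= D1z /flat_exp.
  case: ifP => // _; rewrite mulr_ge0 ?expR_ge0//; set w := z^-1.
  rewrite /flat_exp_deriv derivC subr0 derivD derivC add0r derivM derivC mulr0.
  rewrite addr0 derivXn !hornerE /=.
  (* the quartic in [w] as a sum of squares *)
  have : 0 <= c * ((w ^+ 2 - w) ^+ 2 + w ^+ 2 + 1).
    by rewrite mulr_ge0// !addr_ge0// sqr_ge0.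
  by congr (is_true (0 <= _)); ring.
- apply: cvg_at_left_filter; exact: continuous_flat_exp.
- apply: cvg_at_right_filter; exact: continuous_flat_exp.
- by move=> z _; apply: ex_derive; exact: is_derive_flat_exp.
- by move=> z _; apply: ex_derive; exact: is_derive_flat_exp.
Qed.

End FlatFunction.

(** * Epigraphs *)

Section Epigraph.
Context {R : realType}.
Implicit Types (g u : R -> R) (p x e : (R * R)%type).

Definition epigraph g : set (R * R)%type := [set p | g p.1 < p.2].

Lemma convex_epigraph g :
  convex_function (setT : set R^o) g -> convex_set (epigraph g).
Proof.
move=> gc; apply/convex_setW => -[x1 x2] [y1 y2]; rewrite !inE /epigraph /=.
move=> gx gy k k0 k1; apply/mem_set.
apply: (le_lt_trans (gc k x1 y1 (in_setT _) (in_setT _))); rewrite convRE.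
by rewrite ltrD// ltr_pM2l// subr_gt0.
Qed.

Lemma open_epigraph g : continuous g -> open (epigraph g).
Proof.
move=> gc.
rewrite (_ : epigraph g = (fun p => p.2 - g p.1) @^-1` [set z | 0 < z]).
  apply: open_comp; last exact: open_gt.
  move=> p _; apply: cvgB; first exact: cvg_snd.
  by apply: (@continuous_comp _ _ _ fst g); [exact: cvg_fst|exact: gc].
by apply/seteqP; split => p /=; rewrite subr_gt0.
Qed.

Lemma boundary_epigraph g p : continuous g ->
  boundary (epigraph g) p <-> p.2 = g p.1.
Proof.
move=> gc; rewrite /boundary.
have /interior_id -> := open_epigraph gc.
split=> [[cp /negP]|pg].
- rewrite -leNgt => pg; apply/eqP; rewrite eq_le pg /=.
  have : closed [set q : (R * R)%type | g q.1 <= q.2].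
    rewrite (_ : [set _ | _] = (fun p => p.2 - g p.1) @^-1` [set z | 0 <= z]).
      apply: closed_comp; last exact: closed_ge.
      move=> q _; apply: cvgB; first exact: cvg_snd.
      by apply: (@continuous_comp _ _ _ fst g); [exact: cvg_fst|exact: gc].
    by apply/seteqP; split => q /=; rewrite subr_ge0.
  by apply; apply: closure_subset cp => q /ltW.
- split; last by rewrite /epigraph /= pg ltxx.
  have h : (p.1, p.2 + t) @[t --> (0 : R)^'+] --> p.
    case: p {pg} => p1 p2 /=.
    apply: (@cvg_pair _ _ _ _ (nbhs p1) (nbhs p2)); first exact: cvg_cst.
    rewrite -{2}[p2]addr0; apply: cvgD; first exact: cvg_cst.
    exact: cvg_within.
  move=> B /h hB.
  have : \forall t \near (0 : R)^'+,
      epigraph g (p.1, p.2 + t) /\ B (p.1, p.2 + t).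
    near=> t; split; last by near: t.
    by rewrite /epigraph /= -pg ltrDl.
  by move=> /filter_ex[t ?]; exists (p.1, p.2 + t).
Unshelve. all: by end_near. Qed.

Lemma frame_ptE x e (s y : R) :
  frame_pt x e s y = (x.1 + s * e.2 + y * e.1, x.2 - s * e.1 + y * e.2).
Proof. by rewrite -mulrN. Qed.

Lemma derive1n_shift g (c z : R) n :
  derive1n n.+1 (fun s => g (z + s) - c) = fun s => derive1n n.+1 g (z + s).
Proof.
have congr_lim (F G : R -> R) : F =1 G -> lim (F @ 0^') = lim (G @ 0^').
  by move=> /funext ->.
elim: n => [|n IH]; apply/funext => s.
  rewrite !derive1n1 /derive1; apply: congr_lim => h /=.
  by rewrite opprB addrA subrK addrCA.
rewrite derive1nS IH [in RHS]derive1nS /derive1.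
by apply: congr_lim => h /=; rewrite addrCA.
Qed.

Lemma smooth_epigraph g :
  (forall n z, derivable (derive1n n g) z 1) -> smooth_boundary (epigraph g).
Proof.
move=> gs.
have gnc n : continuous (derive1n n g).
  by move=> z; apply/differentiable_continuous/derivable1_diffP.
have gc : continuous g := gnc 0.
move=> p; rewrite boundary_epigraph// => pE.
pose u s := g (p.1 + s) - g p.1.
have [a a0 ua] : exists2 a : R, 0 < a & forall s, `|s| < a -> `|u s| < 1.
  have gp : g (p.1 + s) @[s --> (0 : R)] --> g (p.1 + 0).
    apply: (@continuous_comp _ _ _ (fun s => p.1 + s) g); last exact: gc.
    by apply: cvgD; [exact: cvg_cst|exact: cvg_id].
  have : u s @[s --> (0 : R)] --> g (p.1 + 0) - g p.1.
    by apply: cvgB => //; exact: cvg_cst.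
  rewrite addr0 subrr.
  move/cvgr0_norm_lt => /(_ _ ltr01)/nbhs_ballP[a /= a0 aP].
  by exists a => // s sa; apply: aP; rewrite /ball /= sub0r normrN.
exists (0, 1), a, 1, u; split.
  split => //; first by rewrite /dotp /= mulr0 mulr1 add0r.
  move=> s y sa y1; rewrite frame_ptE /= !mulr1 !mulr0 !addr0 subr0.
  rewrite /epigraph /u /= pE.
  split=> [|us|us]; first last.
  - by apply/negP; rewrite -leNgt -lerBrDl; exact: ltW.
  - by rewrite -ltrBlDl.
  split; first by move/(boundary_epigraph _ gc) => /= <-; rewrite addrC addKr.
  by move=> ->; apply/(boundary_epigraph _ gc); rewrite /= subrKC.
move=> k s sa.
have ud n : derivable (derive1n n u) s 1.
  case: n => [|n].
    apply: derivableB; last exact: derivable_cst.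
    apply/derivable1_diffP; apply: differentiable_comp; first by [].
    by apply/derivable1_diffP; exact: (gs 0).
  rewrite derive1n_shift.
  apply/derivable1_diffP; apply: differentiable_comp; first by [].
  by apply/derivable1_diffP; exact: (gs n.+1).
by split=> //; apply/differentiable_continuous/derivable1_diffP.
Qed.

End Epigraph.

(** * Flat boundary points *)

Section FlatBoundary.
Context {R : realType}.
Implicit Types (E : set (R * R)%type) (x e n : (R * R)%type) (u : R -> R).

(** Near [x], the set [E] is the half-plane above the horizontal line through
[x]; as in the definition of a local graph, points of the line itself may or may
not belong to [E]. *)
Definition flat_at E x : Prop := \forall q \near x,
  [/\ boundary E q <-> q.2 = x.2, (x.2 < q.2 -> E q) & (q.2 < x.2 -> ~ E q)].

Lemma flat_at_near E x :
  flat_at E x -> \forall q \near x, q.2 = x.2 -> flat_at E q.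
Proof.
move=> /near_join fx; near=> q => qx; rewrite /flat_at qx.
by near: q.
Unshelve. all: by end_near. Qed.

Lemma cvg_frame_pt (T : Type) (F : set_system T) {FF : Filter F}
    (f g : T -> R) (s y : R) x e :
  f t @[t --> F] --> s -> g t @[t --> F] --> y ->
  frame_pt x e (f t) (g t) @[t --> F] --> frame_pt x e s y.
Proof.
move=> fs gy; apply: cvgD; last exact: cvgZr_tmp.
by apply: cvgD; [exact: cvg_cst|exact: cvgZr_tmp].
Qed.

Lemma frame_pt00 x e : frame_pt x e 0 0 = x.
Proof. by rewrite /frame_pt !scale0r !addr0. Qed.

Lemma frame_pt_graph_line x e (s : R) : dotp e e = 1 -> e.2 != 0 ->
  frame_pt x e s (s * (e.1 / e.2)) = (x.1 + s / e.2, x.2).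
Proof.
rewrite /dotp => e1 e20; rewrite frame_ptE; congr pair; last by field.
rewrite -[in RHS](mulr1 s) -e1; by field.
Qed.

(** A line that is a graph over the first axis of the frame is not parallel to
the second one, which gives [e.2 != 0]; the side of [E] gives the sign. *)
Lemma flat_local_graph E x e (a b : R) u :
  flat_at E x -> local_graph E x e a b u ->
  0 < e.2 /\ \forall s \near (0 : R), u s = s * (e.1 / e.2).
Proof.
move=> fx [a0 b0 e1 ub hu].
have near_frame (f g : R -> R) :
    continuous f -> continuous g -> f 0 = 0 -> g 0 = 0 ->
    \forall t \near (0 : R), [/\ `|f t| < a, `|g t| < b &
      let q := frame_pt x e (f t) (g t) in
      [/\ boundary E q <-> q.2 = x.2, (x.2 < q.2 -> E q) &
           (q.2 < x.2 -> ~ E q)]].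
  move=> fc gc f0 g0.
  have := @cvg_frame_pt _ _ (nbhs_filter (0 : R)) f g _ _ x e (fc 0) (gc 0).
  rewrite f0 g0 frame_pt00 => fg0.
  have := fc 0; rewrite /continuous_at f0 => /cvgr0_norm_lt fa.
  have := gc 0; rewrite /continuous_at g0 => /cvgr0_norm_lt gb.
  near=> t; split; [by near: t; exact: fa|by near: t; exact: gb|].
  by near: t; exact: (fg0 _ fx).
have cid : continuous (id : R -> R) by move=> ?; exact: cvg_id.
have c0 : continuous (cst 0 : R -> R) by move=> ?; exact: cvg_cst.
have cm : continuous (fun s : R => s * (e.1 / e.2)) by move=> ?; exact: cvgMl.
(* along the second axis, at the points [x + y *: e] *)
pose slope (y : R) := [/\ y * e.2 = 0 <-> y = u 0,
  (u 0 < y -> 0 <= y * e.2) & (y < u 0 -> y * e.2 <= 0)].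
have near_slope : \forall y \near (0 : R), slope y.
  have := near_frame _ _ c0 cid erefl erefl.
  apply: filterS => y [y0 yb [hb hE hnE]].
  have [hb' hE' hnE'] := hu _ _ y0 yb.
  rewrite frame_ptE /= !mul0r subr0 in hb hE hnE hb' hE' hnE'.
  split.
  - rewrite -hb' hb; split => [->|]; first by rewrite addr0.
    by move/(canRL (addKr _)); rewrite addNr.
  - move=> /hE' Ey; rewrite leNgt; apply/negP => y2.
    by apply: hnE Ey; rewrite gtrDl.
  - move=> /hnE' Ey; rewrite leNgt; apply/negP => y2.
    by apply/Ey/hE; rewrite ltrDl.
have u0 : 0 = u 0.
  by have [hu0 _ _] := nbhs_singleton near_slope; apply/hu0; rewrite mul0r.
have [y y0 [ye uy _]] : exists2 y : R, 0 < y & slope y.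
  have /filter_ex[y [y0 ys]] : \forall y \near (0 : R)^'+, 0 < y /\ slope y.
    by near=> y; split => //; near: y; exact: cvg_within near_slope.
  by exists y.
have e2 : 0 < e.2.
  rewrite -u0 in ye uy; rewrite -(pmulr_rgt0 _ y0) lt_neqAle uy// andbT eq_sym.
  by apply/eqP => /ye yE; rewrite yE ltxx in y0.
split => //.
(* the points of the horizontal line through [x], in the frame *)
have := near_frame _ _ cid cm erefl (mul0r _).
apply: filterS => s [sa sb [hb _ _]].
have [hb' _ _] := hu _ _ sa sb; apply/esym/hb'/hb.
by rewrite frame_pt_graph_line// gt_eqF.
Unshelve. all: by end_near. Qed.

End FlatBoundary.

(** * Normal, curvature and r-curvature at flat points *)

Section FlatGeometry.
Context {R : realType}.
Implicit Types (E : set (R * R)%type) (x e n : (R * R)%type) (u : R -> R).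

Lemma derive1_near_linear u (m : R) :
  (\forall s \near (0 : R), u s = s * m) ->
  \forall s \near (0 : R), derive1 u s = m.
Proof.
move=> /near_join hu; near=> s; rewrite derive1E.
rewrite (@near_eq_derive _ _ _ u (fun s => s * m)); last by near: s.
have h : is_derive s 1 (fun s : R => s * m) (s *: 0 + m *: 1).
  exact: is_deriveM.
by rewrite (@derive_val _ _ _ _ _ _ _ h) scaler0 add0r [_%:A]mulr1.
Unshelve. all: by end_near. Qed.

(** All the graph representations of the boundary at [x] give the same vector;
smoothness provides one of them. *)
Lemma outer_normal_flat E x : smooth_boundary E -> flat_at E x ->
  outer_normal E x = (0, -1).
Proof.
move=> Es fx; have bx : boundary E x.
  by have [hb _ _] := nbhs_singleton fx; apply/hb.
rewrite /outer_normal; case: xgetP => [n _ [e [a [b [u [ug _ ->]]]]]|noN].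
  have [e2 hu] := flat_local_graph fx ug; have [_ _ e1 _ _] := ug.
  have -> := nbhs_singleton (derive1_near_linear hu).
  rewrite /dotp -!expr2 in e1.
  have -> : 1 + (e.1 / e.2) ^+ 2 = (e.2^-1) ^+ 2.
    rewrite -[e.2^-1]mul1r expr_div_n expr1n -[X in _ = X / _]e1.
    by field; rewrite gt_eqF.
  rewrite sqrtr_sqr ger0_norm ?invr_ge0 ?ltW// invrK.
  rewrite /tangent; case: e e1 e2 {ug hu} => p q /= e1 q0.
  transitivity (q * (p / q * q - p), q * (p / q * - p - q)) => //.
  by rewrite -[1]e1; congr pair; field; rewrite gt_eqF.
have [e [a [b [u [ug us]]]]] := Es x bx.
exfalso; apply: noN; do 4 eexists; split; [exact: ug|exact: us|by []].
Qed.

Lemma curvature_flat E x : flat_at E x -> curvature E x = 0.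
Proof.
move=> fx; rewrite /curvature.
case: xgetP => [k _ [e [a [b [u [ug _ ->]]]]]|//].
have [_ hu] := flat_local_graph fx ug.
have -> : derive1n 2 u 0 = 0; last by rewrite mul0r.
rewrite derive1nS derive1n1 derive1E.
rewrite (near_eq_derive (1 : R) (derive1_near_linear hu)).
exact: derive_cst.
Qed.

Lemma r_curvature_flat (r : R) E x : flat_at E x ->
  ext_ball r E x `<=` ~` E ->
  r_curvature r E x = if `[< int_ball r E x `<=` E >] then 0 else 1 / (2 * r).
Proof.
move=> fx /asboolP ext; rewrite /r_curvature /kappa_plus /kappa_minus ext.
rewrite curvature_flat// mul0r add0r sub0r.
by case: ifP; rewrite ?addr0// subrr.
Qed.

End FlatGeometry.

(** * A jump of the r-curvature on a flat part prevents convexity *)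

Section Evolution.
Context {R : realType}.

Lemma derivative_within_sub (V : normedModType R) (D D' : set R) (f : R -> V)
    (t : R) (l : V) :
  (\forall h \near (0 : R)^', D' (t + h) -> D (t + h)) ->
  derivative_within D f t l -> derivative_within D' f t l.
Proof.
move=> DD' dl; apply: cvg_trans dl; apply: cvg_app => A DA.
by apply: filterS2 DD' DA => h DD hA hD'; exact/hA/DD.
Qed.

Lemma derivative_within_right (V : normedModType R) (D : set R) (f : R -> V)
    (t : R) (l : V) :
  (\forall h \near (0 : R)^'+, D (t + h)) ->
  derivative_within D f t l ->
  h^-1 *: (f (t + h) - f t) @[h --> (0 : R)^'+] --> l.
Proof.
move=> Dt dl; apply: cvg_trans dl; apply: cvg_app => A DA.
have D0 : nbhs (0 : R) (fun h => h != 0 -> D (t + h) -> A h) := DA.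
have Dt0 : nbhs (0 : R) (fun h => 0 < h -> D (t + h)) := Dt.
change (nbhs (0 : R) (fun h => 0 < h -> A h)).
by apply: filterS2 D0 Dt0 => h hA hD h0; apply: hA (hD h0); rewrite gt_eqF.
Qed.

End Evolution.

Section Obstruction.
Context {R : realType}.
Implicit Types (E : set (R * R)%type) (x e : (R * R)%type) (u : R -> R).

Lemma convex_function_midpoint (D : set R^o) u (s1 s2 : R) :
  convex_function D u -> D s1 -> D s2 ->
  u ((s1 + s2) / 2) <= (u s1 + u s2) / 2.
Proof.
move=> uc D1 D2.
have : u (2^-1 * s1 + (1 - 2^-1) * s2) <= 2^-1 * u s1 + (1 - 2^-1) * u s2.
  have h0 : (0 : R) <= 2^-1 by [].
  have h1 : (2^-1 : R) <= 1 by lra.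
  exact: (uc (Itv01 h0 h1) s1 s2 (mem_set D1) (mem_set D2)).
have -> : 1 - 2^-1 = 2^-1 :> R by lra.
by rewrite -!mulrDr ![_ / 2]mulrC.
Qed.

(** In the frame given at time [0], the graph over [s] moves with the velocity
[V *: e], and the flow equation reads [V * e.2 = r_curvature]. So the initial
speeds at [- h], [h], [3 * h] are [0], [c / e.2], [c / e.2], while the midpoint
inequality for [u t], after subtracting the affine [u 0] and dividing by [t],
gives in the limit that the middle one is at most [c / (2 * e.2)]. *)
Lemma no_convex_flow (r c T : R) E x :
  smooth_boundary E -> flat_at E x -> 0 < c ->
  (\forall z \near x, z.2 = x.2 -> (z.1 < x.1 -> r_curvature r E z = 0) /\
                                   (x.1 < z.1 -> r_curvature r E z = c)) ->
  0 < T ->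
  ~ exists Et : R -> set (R * R)%type,
      [/\ Et 0 = E, r_curvature_flow r T Et & C1_in_time T Et].
Proof.
move=> Es fx c0 jump T0 [Et [E0 [_ flow] C1]].
have T00 : 0 \in `[0, T[ by rewrite in_itv /= lexx.
have bx : boundary (Et 0) x.
  by rewrite E0; have [hb _ _] := nbhs_singleton fx; apply/hb.
have [e [a [b [eta [u]]]]] := C1 0 T00 x bx.
set J := _ `&` _ => -[eta0 ug uc ud].
have J0 : J 0 by split; rewrite /= ?subrr ?normr0.
have g0 := ug 0 J0; rewrite E0 in g0.
have [e2 hu] := flat_local_graph fx g0; have [a0 _ e1 _ _] := g0.
pose inJ (t : R) := t \in `[0, T[ -> J t.
have nearJ : \forall t \near (0 : R), inJ t.
  have : \forall t \near (0 : R), `|t| < eta by exact: nbhs0_lt.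
  apply: filterS => t te tT.
  by split; rewrite //= subr0.
have rightJ : \forall h \near (0 : R)^'+, J (0 + h).
  near=> h; rewrite add0r.
  have hJ : inJ h by near: h; exact: cvg_within nearJ.
  apply: hJ; rewrite in_itv /=; apply/andP; split; first exact: ltW.
  by near: h; exact: nbhs_right_lt.
have near_pt (P : set (R * R)%type) : nbhs x P ->
    \forall s \near (0 : R), P (x.1 + s / e.2, x.2).
  have cid : id s @[s --> (0 : R)] --> (0 : R) by exact: cvg_id.
  have cm : s * (e.1 / e.2) @[s --> (0 : R)] --> 0 * (e.1 / e.2).
    exact: cvgMl.
  have := @cvg_frame_pt _ _ _ (nbhs_filter (0 : R)) _ _ _ _ x e cid cm.
  rewrite mul0r frame_pt00 => /[apply]; rewrite nbhs_simpl /=.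
  by apply: filterS => s /=; rewrite frame_pt_graph_line// gt_eqF.
(* the point over [s] of the boundary at time [0] *)
pose pt (s : R) := (x.1 + s / e.2, x.2).
pose good (s : R) := [/\ `|s| < a, u 0 s = s * (e.1 / e.2),
  flat_at E (pt s),
  (s < 0 -> r_curvature r E (pt s) = 0) &
  (0 < s -> r_curvature r E (pt s) = c)].
have na : \forall s \near (0 : R), `|s| < a by exact: nbhs0_lt.
have near_good : \forall s \near (0 : R), good s.
  near=> s.
  have sa : `|s| < a by near: s; exact: na.
  have us : u 0 s = s * (e.1 / e.2) by near: s; exact: hu.
  have [fs js] : (x.2 = x.2 -> flat_at E (pt s)) /\
      (x.2 = x.2 -> ((pt s).1 < x.1 -> r_curvature r E (pt s) = 0) /\
        (x.1 < (pt s).1 -> r_curvature r E (pt s) = c)).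
    by near: s; exact: (near_pt _ (filterI (flat_at_near fx) jump)).
  have [js1 js2] := js erefl; split; [by []|by []|exact: fs|move=> s0..].
    by apply: js1; rewrite gtrDl pmulr_llt0 ?invr_gt0.
  by apply: js2; rewrite ltrDl divr_gt0.
have speed s V : good s -> derivative_within J (u ^~ s) 0 V ->
    V * e.2 = r_curvature r E (pt s).
  move=> [sa us fs _ _] dV.
  pose X t := frame_pt x e s (u t s).
  have X0 : X 0 = pt s.
    by rewrite /X us frame_pt_graph_line// gt_eqF.
  have := flow 0 T00 X (V *: e).
  rewrite X0 E0 outer_normal_flat// /dotp /= mulr0 add0r mulrN1.
  move=> h; apply: oppr_inj; apply: h.
    near=> t; have Jt : J t by near: t; exact: nearJ.
    have [_ _ _ ub hub] := ug t Jt.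
    by have [hb _ _] := hub s (u t s) sa (ub s sa); apply/hb.
  apply: (@derivative_within_sub _ _ J).
    near=> h; rewrite add0r; near: h; exact: cvg_within nearJ.
  rewrite /derivative_within (_ : (fun h : R => _) =
      (fun h : R => (h^-1 *: (u (0 + h) s - u 0 s)) *: e)).
    exact: cvgZr_tmp.
  apply/funext => h; rewrite -scalerA; congr (_ *: _).
  by rewrite /X /frame_pt opprD addrACA subrr add0r scalerBl.
have [d d0 dgood] : exists2 d : R, 0 < d & forall s, `|s| < d -> good s.
  have /nbhs_ballP[d /= d0 hd] := near_good.
  by exists d => // s sd; apply: hd; rewrite /ball /= sub0r normrN.
have h0 : 0 < d / 4 by rewrite divr_gt0.
set h := d / 4 in h0.
have gN : good (- h) by apply: dgood; rewrite normrN gtr0_norm// /h; lra.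
have g1 : good h by apply: dgood; rewrite gtr0_norm// /h; lra.
have g3 : good (3 * h) by apply: dgood; rewrite gtr0_norm /h; lra.
have right_speed s : good s -> exists V, V * e.2 = r_curvature r E (pt s) /\
    t^-1 *: (u (0 + t) s - u 0 s) @[t --> (0 : R)^'+] --> V.
  move=> gs; have [sa _ _ _ _] := gs; have [v [dv _]] := ud s sa.
  exists (v 0); split; first exact/speed/dv.
  exact: derivative_within_right rightJ (dv 0 J0).
have [VN [VNE VNc]] := right_speed _ gN.
have [V1 [V1E V1c]] := right_speed _ g1.
have [V3 [V3E V3c]] := right_speed _ g3.
pose q s t : R := t^-1 * (u (0 + t) s - u 0 s).
have V_mid : V1 <= (VN + V3) / 2.
  have Vc : (q (- h) t + q (3 * h) t) / 2 @[t --> (0 : R)^'+] --> (VN + V3) / 2.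
    by apply: cvgMl; exact: cvgD.
  apply: (ler_cvg_to V1c Vc).
  near=> t.
  have t0 : 0 < t by [].
  have Jt : J (0 + t) by near: t.
  have [hNa uN _ _ _] := gN; have [_ u1 _ _ _] := g1; have [h3a u3 _ _ _] := g3.
  have := convex_function_midpoint (uc _ Jt) hNa h3a.
  rewrite (_ : (- h + 3 * h) / 2 = h); last by field.
  move=> umid; rewrite -[leLHS]/(q h t) /q -mulrDr -mulrA ler_pM2l ?invr_gt0//.
  rewrite uN u1 u3; set m := e.1 / e.2; lra.
have [_ _ _ kN _] := gN; have [_ _ _ _ k1] := g1; have [_ _ _ _ k3] := g3.
rewrite kN ?oppr_lt0// in VNE; rewrite k1// in V1E.
rewrite k3 ?mulr_gt0// in V3E.
have := ler_wpM2r (ltW e2) V_mid.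
rewrite V1E mulrAC mulrDl VNE V3E add0r; lra.
Unshelve. all: by end_near. Qed.

End Obstruction.

(** * A smooth convex set with such a jump *)

Section Counterexample.
Context {R : realType}.
Implicit Types (g : R -> R) (x : (R * R)%type) (r s : R).

Lemma diskE (p q : (R * R)%type) r :
  disk p r q = ((q.1 - p.1) ^+ 2 + (q.2 - p.2) ^+ 2 < r ^+ 2) :> Prop.
Proof. by []. Qed.

Lemma disk_coord p r q : 0 < r -> disk p r q ->
  (p.1 - r < q.1 < p.1 + r) /\ (p.2 - r < q.2 < p.2 + r).
Proof.
move=> r0; rewrite diskE => qp.
have sqr_lt (u v : R) : (u - v) ^+ 2 < r ^+ 2 -> v - r < u < v + r.
  by move=> uv; apply/andP; split; nra.
by split; apply: sqr_lt; apply: le_lt_trans qp; rewrite ?lerDl ?lerDr sqr_ge0.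
Qed.

Lemma addr_scale_down x r : x + r *: (0, -1) = (x.1, x.2 - r).
Proof.
transitivity (x.1 + r * 0, x.2 + r * -1) => //.
by rewrite mulr0 addr0 mulrN1.
Qed.

Lemma flat_at_epigraph g x : continuous g ->
  (\forall s \near x.1, g s = x.2) -> flat_at (epigraph g) x.
Proof.
move=> gc gx; rewrite /flat_at.
have nx : \forall q \near x, g q.1 = x.2.
  by case: x gx => x1 x2 /= gx; exact: cvg_fst gx.
near=> q; have qx : g q.1 = x.2 by near: q.
rewrite /epigraph /= qx; split => //.
  by have := boundary_epigraph q gc; rewrite qx.
by move=> qx2; apply/negP; rewrite -leNgt ltW.
Unshelve. all: by end_near. Qed.

Lemma ext_ball_epigraph g r x : (forall s, x.2 <= g s) ->
  outer_normal (epigraph g) x = (0, -1) -> 0 < r ->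
  ext_ball r (epigraph g) x `<=` ~` epigraph g.
Proof.
move=> gx nx r0 q; rewrite /ext_ball nx addr_scale_down.
move=> /disk_coord[]// _ /andP[_ /=].
rewrite subrK => qx; apply/negP; rewrite -leNgt.
exact: le_trans (ltW qx) (gx _).
Qed.

(** A disk inside the epigraph stays inside when it moves to the left, because
[g] is nondecreasing; [z] is the supremum of the abscissas of these disks. *)
Lemma int_ball_jump g r : 0 < r -> {homo g : s t / s <= t} ->
  (forall s, s <= 0 -> g s = 0) -> r <= g (r / 4) ->
  exists2 z : R, z < 0 & forall s,
    (s < z -> disk (s, r) r `<=` epigraph g) /\
    (z < s -> ~ disk (s, r) r `<=` epigraph g).
Proof.
move=> r0 gi g0 gr; pose S : set R := [set s | disk (s, r) r `<=` epigraph g].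
have Sdown s t : s <= t -> S t -> S s.
  move=> st St q; rewrite diskE /= => qs; rewrite /epigraph /=.
  apply: le_lt_trans (St (q.1 + (t - s), q.2) _).
    by apply: gi; rewrite lerDl subr_ge0.
  by rewrite diskE /= (_ : q.1 + (t - s) - t = q.1 - s)//; ring.
have S0 : S (- r).
  move=> q /disk_coord[]//= q1 q2; rewrite /epigraph /= g0; lra.
have Sub : ubound S (- (r / 4)).
  move=> s Ss; rewrite leNgt; apply/negP => rs.
  (* at this point of the disk [g] is at least [g (r / 4)] *)
  have : epigraph g (s + r / 2, r).
    by apply: Ss; rewrite diskE /= subrr; nra.
  apply/negP; rewrite /= -leNgt; apply: le_trans gr _.
  by apply: gi; lra.
have supS : has_sup S by split; [exists (- r)|exists (- (r / 4))].
exists (sup S).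
  by apply: le_lt_trans (ge_sup supS.1 Sub) _; rewrite oppr_lt0 divr_gt0.
move=> s; split=> [sS|Ss].
  have [t St st] := sup_gt supS.1 sS.
  by apply: Sdown St; exact: ltW.
by move=> /(ub_le_sup supS.2); rewrite leNgt Ss.
Qed.

(** The [z] of [int_ball_jump] is negative, so the jump takes place inside the
flat part of the boundary. *)
Lemma exists_smooth_convex_jump r : 0 < r -> exists (E : set (R * R)%type) x,
  [/\ convex_set E, smooth_boundary E, flat_at E x &
    \forall z \near x, z.2 = x.2 -> (z.1 < x.1 -> r_curvature r E z = 0) /\
                       (x.1 < z.1 -> r_curvature r E z = 1 / (2 * r))].
Proof.
(* for this [K] the graph has height [r] at [r / 4] *)
move=> r0; pose K : R := r / flat_exp 1%:P (r / 4).
have f0 : 0 < flat_exp 1%:P (r / 4) by rewrite flat_exp_const_gt0// divr_gt0.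
have K0 : 0 < K by rewrite divr_gt0.
pose g := flat_exp K%:P; pose E := epigraph g.
have gc : continuous g by exact: continuous_flat_exp.
have gi : {homo g : s t / s <= t} by apply: flat_exp_const_homo; exact: ltW.
have g0 s : s <= 0 -> g s = 0 by exact: flat_exp_le0.
have gr : r <= g (r / 4).
  have -> : g (r / 4) = K * flat_exp 1%:P (r / 4).
    by rewrite /g /flat_exp divr_gt0// !hornerC mul1r.
  by rewrite /K divfK// gt_eqF.
have [z z0 hz] := int_ball_jump r0 gi g0 gr.
have g_ge0 s : 0 <= g s.
  by have [/g0->//|s0] := leP s 0; rewrite -(g0 0)// gi// ltW.
have Es : smooth_boundary E.
  by apply: smooth_epigraph => n s; exact: derivable_derive1n_flat_exp.
have flatE s : s < 0 -> flat_at E (s, 0).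
  move=> s0; apply: flat_at_epigraph => //=; near=> t; apply: g0.
  by apply: ltW; near: t; exact: lt_nbhsl.
have kE s : s < 0 -> r_curvature r E (s, 0) =
    if `[< disk (s, r) r `<=` E >] then 0 else 1 / (2 * r).
  move=> s0; have n := outer_normal_flat Es (flatE _ s0).
  rewrite r_curvature_flat; [|exact: flatE|exact: ext_ball_epigraph].
  by rewrite /int_ball n -scaleNr addr_scale_down opprK add0r.
exists E, (z, 0); split => //.
- by apply: convex_epigraph; apply: flat_exp_const_convex; exact: ltW.
- exact: flatE.
- have neg : \forall q \near (z, 0 : R), q.1 < 0.
    have : \forall t \near z, t < 0 by exact: lt_nbhsl.
    by move=> nz; exact: (cvg_fst nz).
  near=> q; have q0 : q.1 < 0 by near: q.
  move=> /= qz; have -> : r_curvature r E q = r_curvature r E (q.1, 0).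
    by rewrite -qz -surjective_pairing.
  rewrite kE//; have [hl hr] := hz q.1; split=> h.
    by rewrite ifT//; apply/asboolP/hl.
  by rewrite ifF//; apply/negbTE/asboolPn/hr.
Unshelve. all: by end_near. Qed.

End Counterexample.

Theorem theorem1p6 (R : realType) (r : R) (hr : 0 < r <= 1) :
  exists E : set (R * R)%type,
    [/\ convex_set E, smooth_boundary E &
        forall T : R, 0 < T ->
          ~ exists Et : R -> set (R * R)%type,
              [/\ Et 0 = E,
                  r_curvature_flow r T Et,
                  C1_in_time T Et &
                  forall t : R, 0 < t < T -> convex_set (Et t)]].
Proof.
have /andP[r0 _] := hr.
have [E [x [cE sE fx jump]]] := exists_smooth_convex_jump r0.
exists E; split => // T T0 [Et [E0 flow C1 _]].
apply: (no_convex_flow sE fx _ jump T0); first by rewrite divr_gt0// mulr_gt0.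
by exists Et.
Qed.
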